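(* Let $\lambda$ be a Borel measure on $\mathbb{R}^d$, let $\emptyset\neq\Omega\subseteq\mathbb{R}^d$ be open with $\lambda(\Omega)<\infty$, and let $K\in\mathcal{K}$ be $\lambda$-symmetric. Assume that the nonlocal Friedrichs inequality holds in $V_0$. Then there is a constant $C>0$ such that for all $f\in L^2(\Omega,\lambda)$ and $g\in T$ the nonlocal Dirichlet problem ($\mathcal{L}u=f$ in $\Omega$, $u=g$ in $\Gamma$) has a unique weak solution $u\in V$, and $$\|u\|_V\le C\big(\|f\|_{L^2(\Omega,\lambda)}+\|g\|_T\big).$$ In particular, $u$ depends continuously on the Dirichlet data $(f,g)\in L^2(\Omega,\lambda)\times T$.
   Context: A transition kernel is a map $K:\mathbb{R}^d\times\mathcal{B}(\mathbb{R}^d)\to[0,\infty]$ ($\mathcal{B}(\mathbb{R}^d)$ the Borel $\sigma$-algebra) such that $K(x,\cdot)$ is a $\sigma$-finite measure for every $x$ and $K(\cdot,A)$ is Borel measurable for every $A$. It is non-degenerated if $x\mapsto\int f(x,y)\,K(x,\mathrm{d}y)$ is Borel measurable for every non-negative Borel measurable $f:\mathbb{R}^d\times\mathbb{R}^d\to\mathbb{R}$; $\mathcal{K}$ is the set of non-degenerated transition kernels. For a Borel measure $\lambda$, $K\in\mathcal{K}$ is $\lambda$-symmetric if $\lambda\otimes K=K\otimes\lambda$, where $(\lambda\otimes K)(M)=\int\int\chi_M(x,y)\,K(x,\mathrm{d}y)\,\mathrm{d}\lambda(x)$ and $(K\otimes\lambda)(M)=\int\int\chi_M(x,y)\,K(y,\mathrm{d}x)\,\mathrm{d}\lambda(y)$.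 $\Gamma=\{y\in\mathbb{R}^d\setminus\Omega: K(y,\Omega)>0\}$ and $\mathcal{L}u(x)=\operatorname{PV}\int_{\mathbb{R}^d}(u(x)-u(y))\,K(x,\mathrm{d}y)$. $\mathcal{V}$ is the space of Borel measurable $v:\mathbb{R}^d\to\mathbb{R}$ with $\|v\|_{\mathcal{V}}^2=\int_\Omega v^2\,\mathrm{d}\lambda+\int_\Omega\int_{\mathbb{R}^d}(v(x)-v(y))^2\,K(x,\mathrm{d}y)\,\mathrm{d}\lambda(x)<\infty$, and $\mathcal{V}_0=\{v\in\mathcal{V}: v=0\text{ on }\mathbb{R}^d\setminus\Omega\}$. $V$ and $V_0$ are the spaces of classes of elements of $\mathcal{V}$ and $\mathcal{V}_0$, respectively, modulo $\ker\|\cdot\|_{\mathcal{V}}=\{v\in\mathcal{V}: v=0\ \lambda\text{-a.e. on }\Omega\cup\Gamma\}$, with the induced norm $\|\cdot\|_V$; elements of $V$ are treated as functions defined $\lambda$-a.e. on $\Omega\cup\Gamma$. On $V$ set $$\mathcal{B}(u,v)=\tfrac12\int_\Omega\int_\Omega(u(x)-u(y))(v(x)-v(y))\,K(x,\mathrm{d}y)\,\mathrm{d}\lambda(x)+\int_\Omega\int_{\mathbb{R}^d\setminus\Omega}(u(x)-u(y))(v(x)-v(y))\,K(x,\mathrm{d}y)\,\mathrm{d}\lambda(x).$$ The nonlocal Friedrichs inequality holds in $V_0$ if there is $C>0$ with $\|v\|_{L^2(\Omega,\lambda)}^2\le C\,\mathcal{B}(v,v)$ for all $v\in V_0$. The trace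 space is $T=\{v:\Gamma\to\mathbb{R}:\text{there is }u\in V\text{ with }u|_\Gamma=v\}$ (functions identified $\lambda$-a.e. on $\Gamma$) with norm $\|v\|_T=\inf\{\|u\|_V: u\in V,\ u|_\Gamma=v\}$. A weak solution of the Dirichlet problem with data $(f,g)$ is an element $u\in V$ with $u-g\in V_0$ and $\mathcal{B}(u,v)=\int_\Omega f v\,\mathrm{d}\lambda$ for all $v\in V_0$; here $u-g\in V_0$ means $u|_\Gamma=g$, i.e. $u-z\in V_0$ for an extension $z\in V$ of $g$. *)

(* Defs.v *)
From HB Require Import structures.
From mathcomp Require Import all_boot all_order all_algebra.
From mathcomp Require Import all_classical all_reals all_analysis.
From mathcomp Require Import measurable_realfun.

Set Implicit Arguments.
Unset Strict Implicit.
Unset Printing Implicit Defensive.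
Import Order.TTheory GRing.Theory Num.Theory.
Import numFieldNormedType.Exports.

Local Open Scope classical_set_scope.
Local Open Scope ring_scope.

(* R^d with its Borel sigma-algebra.  On R^d x R^d the product sigma-algebra
   is the Borel one, as R^d is second countable. *)
Definition Rd (R : realType) (d : nat) : measurableType _ :=
  [the measurableType _ of g_sigma_algebraType (open : set (set 'rV[R]_d))].

(* An element K of R.-sigmafker X ~> X is a kernel with K x a
   sigma-finite measure for every x and K ^~ A measurable for every
   measurable A. *)
Definition nondegenerate_kernel (R : realType) (d : nat)
    (K : R.-sigmafker Rd R d ~> Rd R d) : Prop :=
  forall f : Rd R d * Rd R d -> R,
    measurable_fun setT f -> (forall z, 0 <= f z) ->
    measurable_fun setT (fun x => \int[K x]_y (f (x, y))%:E)%E.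

Definition kernel_symmetric (R : realType) (d : nat)
    (lambda : {measure set Rd R d -> \bar R})
    (K : R.-sigmafker Rd R d ~> Rd R d) : Prop :=
  forall M : set (Rd R d * Rd R d), measurable M ->
    (\int[lambda]_x \int[K x]_y (\1_M (x, y))%:E =
     \int[lambda]_y \int[K y]_x (\1_M (x, y))%:E)%E.

Section nonlocal_spaces.
Context (R : realType) (d : nat).
Variables (lambda : {measure set Rd R d -> \bar R}) (Omega : set (Rd R d)).

Definition L2 (f : Rd R d -> R) : Prop :=
  measurable_fun Omega f /\
  (\int[lambda]_(x in Omega) (f x ^+ 2)%:E < +oo)%E.

Definition L2norm (f : Rd R d -> R) : R :=
  Num.sqrt (fine (\int[lambda]_(x in Omega) (f x ^+ 2)%:E)).

Variable K : R.-sigmafker Rd R d ~> Rd R d.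

Definition Gamma : set (Rd R d) := [set y | ~ Omega y /\ (0 < K y Omega)%E].

Definition Vnorm_sq (v : Rd R d -> R) : \bar R :=
  (\int[lambda]_(x in Omega) (v x ^+ 2)%:E +
   \int[lambda]_(x in Omega) \int[K x]_y ((v x - v y) ^+ 2)%:E)%E.

Definition Vnorm (v : Rd R d -> R) : R := Num.sqrt (fine (Vnorm_sq v)).

(* An element of the quotient space V is given by any of its representatives
   in calV; equality in V is then Veq, and V0 is the set of representatives
   of the classes that meet calV0. *)
Definition calV : set (Rd R d -> R) :=
  [set v | measurable_fun setT v /\ (Vnorm_sq v < +oo)%E].

Definition calV0 : set (Rd R d -> R) :=
  [set v | calV v /\ forall x, ~ Omega x -> v x = 0].

Definition Veq (u v : Rd R d -> R) : Prop :=
  u = v %[ae lambda in Omega `|` Gamma].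

Definition V0 : set (Rd R d -> R) :=
  [set v | calV v /\ exists2 w, calV0 w & Veq v w].

Definition Bform (u v : Rd R d -> R) : R :=
  2^-1 * fine (\int[lambda]_(x in Omega) \int[K x]_(y in Omega)
                 ((u x - u y) * (v x - v y))%:E)%E
  + fine (\int[lambda]_(x in Omega) \int[K x]_(y in ~` Omega)
            ((u x - u y) * (v x - v y))%:E)%E.

Definition friedrichs : Prop :=
  exists2 C : R, 0 < C & forall v, V0 v -> L2norm v ^+ 2 <= C * Bform v v.

(* Functions on Gamma are given by functions on R^d whose values off Gamma
   are irrelevant; extends u g says that u restricts to g on Gamma. *)
Definition extends (u g : Rd R d -> R) : Prop :=
  u = g %[ae lambda in Gamma].

Definition trace_space : set (Rd R d -> R) :=
  [set g | exists2 u, calV u & extends u g].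

Definition Tnorm (g : Rd R d -> R) : R :=
  inf [set Vnorm u | u in [set u | calV u /\ extends u g]].

Definition weak_solution (f g u : Rd R d -> R) : Prop :=
  [/\ calV u,
      exists z, [/\ calV z, extends z g & V0 (u \- z)] &
      forall v, V0 v ->
        Bform u v = fine (\int[lambda]_(x in Omega) (f x * v x)%:E)%E].

End nonlocal_spaces.

(* Main.v *)
Require Import Defs.
From mathcomp Require Import all_boot all_order all_algebra.
From mathcomp Require Import all_classical all_reals all_analysis.
From mathcomp Require Import measurable_realfun.
From mathcomp Require Import ring lra.

Import Order.TTheory GRing.Theory Num.Theory.
Import numFieldNormedType.Exports.

Local Open Scope classical_set_scope.
Local Open Scope ring_scope.

Set Implicit Arguments.
Unset Strict Implicit.
Unset Printing Implicit Defensive.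

(** A weak solution is sought as [u = z + w], where [z] is an extension of the
    boundary data and [w] vanishes off [Omega]; the equation then says that [w]
    represents the functional [v |-> int f v - B(z, v)] for the form [B].  On the
    functions vanishing off [Omega] the Friedrichs inequality gives
    [|v|_V ^ 2 <= (C + 2) * B(v, v)] ([Vform_le_Bform]), so the functional is
    bounded for the energy norm ([load_bound]), and [w] exists by the Riesz
    theorem ([psd_riesz]) as soon as the energy norm is complete
    ([calV0_complete]).  Testing the equation with [w] itself bounds [u] by the
    data and by the norm of [z] ([weak_solution_le_extension]), and taking the
    infimum over [z] produces the trace norm.  The equation being linear, the
    continuous dependence is this estimate applied to a difference of solutions.

    Everything is done with functions instead of classes, hence with forms that
    are only positive semidefinite.  What makes this consistent is the symmetry
    of the kernel, applied to products of sets: the mass that [Omega] sends to a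
    set [N] is the mass that [N] sends back to [Omega].  Thus a set that is null
    in [Omega `|` Gamma] is null for [K x] for almost every [x] in [Omega]
    ([null_kernel]): the norm, the form [B] and the membership in [V] only depend
    on the values almost everywhere on [Omega `|` Gamma], and an almost
    everywhere limit may be taken under the double integral.  Conversely the
    norm of a function determines it almost everywhere on [Omega `|` Gamma]
    ([Vnorm_sq0_Veq]), which is uniqueness.

    Completeness is obtained as in the Riesz-Fischer theorem: a geometric Cauchy
    sequence converges in [L2] on [Omega], hence almost everywhere on [Omega]
    since the increments are summable ([geometric_cvg_ae]), and Fatou's lemma,
    once for each of the two integrals, bounds the distance to the limit
    ([Vnorm_sq_fatou]). *)

(* Integrals are only handled through their properties. *)
#[local] Opaque integral.

(** * Positive semidefinite forms and the Riesz representation *)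

Lemma quadratic_ge0_disc (R : realType) (a b c : R) : 0 <= a ->
  (forall t, 0 <= t ^+ 2 * a + 2 * t * b + c) -> b ^+ 2 <= a * c.
Proof.
rewrite le_eqVlt => /predU1P[<-|a0] h.
  have [->|b0] := eqVneq b 0; first by rewrite expr0n mul0r.
  (* For [a = 0] the expression is affine in [t] and takes the value -1 here. *)
  have := h (- (c + 1) / (2 * b)).
  rewrite (_ : _ + c = -1); last by field.
  by rewrite lerNr oppr0 ler10.
have := h (- b / a).
rewrite (_ : _ + c = (a * c - b ^+ 2) / a); last by field; rewrite gt_eqF.
by rewrite pmulr_lge0 ?invr_gt0// subr_ge0.
Qed.

Section psd_form.
Context (R : realType) (E : lmodType R).
Implicit Types (S : set E) (b : E -> E -> R) (u v w : E).

Definition subspace S :=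
  S 0 /\ forall (a : R) u v, S u -> S v -> S (a *: u + v).

Definition linear_on S (l : E -> R) :=
  forall (a : R) u v, S u -> S v -> l (a *: u + v) = a * l u + l v.

(** Positivity is only asked for on a subspace [S] and degenerate vectors are
    allowed: functions can then be used in place of their classes. *)
Definition psd_form S b :=
  [/\ forall w, S w -> linear_on S (b ^~ w),
      forall u v, b u v = b v u &
      forall u, S u -> 0 <= b u u].

Lemma psd_formS S S' b : S' `<=` S -> psd_form S b -> psd_form S' b.
Proof.
move=> SS' [l s p]; split => [w /SS' Sw a u v /SS' Su /SS' Sv|//|u /SS' Su].
- exact: l.
- exact: p.
Qed.

Definition form_norm b u := Num.sqrt (b u u).

Context (S : set E) (HS : subspace S).

Lemma subspace0 : S 0. Proof. by case: HS. Qed.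

Lemma subspaceP (a : R) u v : S u -> S v -> S (a *: u + v).
Proof. by case: HS => _; apply. Qed.

Lemma subspaceD u v : S u -> S v -> S (u + v).
Proof. by move=> Su Sv; rewrite -(scale1r u); exact: subspaceP. Qed.

Lemma subspaceZ (a : R) u : S u -> S (a *: u).
Proof.
by move=> Su; rewrite -(addr0 (_ *: _)); apply: subspaceP => //; exact: subspace0.
Qed.

Lemma subspaceB u v : S u -> S v -> S (u - v).
Proof. by move=> Su Sv; rewrite addrC -scaleN1r; exact: subspaceP. Qed.

Lemma linear_onD (l : E -> R) u v :
  linear_on S l -> S u -> S v -> l (u + v) = l u + l v.
Proof. by move=> hl Su Sv; rewrite -[X in X + v]scale1r hl// mul1r. Qed.

Lemma linear_onB (l : E -> R) u v :
  linear_on S l -> S u -> S v -> l (u - v) = l u - l v.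
Proof. by move=> hl Su Sv; rewrite addrC -scaleN1r hl// mulN1r addrC. Qed.

Context (b : E -> E -> R) (Hb : psd_form S b).

Lemma psd_linear w : S w -> linear_on S (b ^~ w).
Proof. by case: Hb => + _ _; apply. Qed.

Lemma psd_sym u v : b u v = b v u. Proof. by case: Hb. Qed.

Lemma psd_ge0 u : S u -> 0 <= b u u. Proof. by case: Hb => _ _; apply. Qed.

Lemma psd_square (a : R) u v : S u -> S v ->
  b (a *: u + v) (a *: u + v) = a ^+ 2 * b u u + 2 * a * b u v + b v v.
Proof.
move=> Su Sv; have Sw : S (a *: u + v) by exact: subspaceP.
rewrite (psd_linear Sw)// !(psd_sym _ (_ + _)) (psd_linear Su)// (psd_linear Sv)//.
by rewrite (psd_sym v u); ring.
Qed.

Lemma psd_cauchy_schwarz u v : S u -> S v -> b u v ^+ 2 <= b u u * b v v.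
Proof.
move=> Su Sv; apply: quadratic_ge0_disc; first exact: psd_ge0.
by move=> t; rewrite -psd_square//; apply: psd_ge0; exact: subspaceP.
Qed.

Lemma psd_norm_cauchy_schwarz u v : S u -> S v ->
  `|b u v| <= form_norm b u * form_norm b v.
Proof.
move=> Su Sv; rewrite /form_norm -sqrtrM ?psd_ge0// -sqrtr_sqr.
by rewrite ler_wsqrtr// psd_cauchy_schwarz.
Qed.

Lemma sqr_form_norm u : S u -> form_norm b u ^+ 2 = b u u.
Proof. by move=> Su; rewrite sqr_sqrtr// psd_ge0. Qed.

Lemma psd_norm_triangle u v : S u -> S v ->
  form_norm b (u + v) <= form_norm b u + form_norm b v.
Proof.
move=> Su Sv; have Suv := subspaceD Su Sv.
rewrite -(@ler_pXn2r _ 2%N)// ?nnegrE ?addr_ge0 ?sqrtr_ge0//.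
rewrite sqr_form_norm// -[in leLHS](scale1r u) psd_square//.
rewrite sqrrD !sqr_form_norm//.
have := le_trans (ler_norm _) (psd_norm_cauchy_schwarz Su Sv).
by rewrite expr1n !mul1r mulr1 mulr2n; lra.
Qed.

(** Asking for the rate [4 ^- n] saves the extraction of subsequences: the
    increments of such a sequence are summable. *)
Definition geometrically_complete := forall v_ : nat -> E,
  (forall n, S (v_ n)) ->
  (forall n k, (n <= k)%N -> b (v_ n - v_ k) (v_ n - v_ k) <= 4^-1 ^+ n) ->
  exists2 u, S u & b (v_ n - u) (v_ n - u) @[n --> \oo] --> (0 : R).

(** The representing vector minimizes [J v := b v v - 2 * l v].  Near
    minimizers are close to each other by the parallelogram law applied to
    their midpoint, and each of them solves the equation up to an error that
    the discriminant of [t |-> J (v + t *: w)] controls. *)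
Theorem psd_riesz (l : E -> R) (M : R) :
  geometrically_complete -> linear_on S l ->
  (forall v, S v -> `|l v| <= M * form_norm b v) ->
  exists2 u, S u & forall w, S w -> b u w = l w.
Proof.
move=> complete_b l_lin l_bd.
pose J v := b v v - 2 * l v.
pose m := inf [set J v | v in S].
have J_lb : has_lbound [set J v | v in S].
  exists (- M ^+ 2) => _ [v Sv <-]; rewrite /J -sqr_form_norm//.
  have := le_trans (ler_norm _) (l_bd v Sv).
  have := sqr_ge0 (form_norm b v - M).
  by rewrite sqrrB mulr2n; lra.
have J_inf : has_inf [set J v | v in S].
  by split => //; exists (J 0); exists 0 => //; exact: subspace0.
have mJ v : S v -> m <= J v by move=> Sv; apply: ge_inf => //; exists v.
have near_min n : exists v, S v /\ J v <= m + 4^-1 ^+ n / 4.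
  have e0 : 0 < 4^-1 ^+ n / 4 :> R by rewrite divr_gt0 ?exprn_gt0 ?invr_gt0.
  by have [_ [v Sv <-] /ltW Jv] := inf_adherent e0 J_inf; exists v.
have [v_ v_min] := choice near_min.
have Sv_ n : S (v_ n) by have [] := v_min n.
have parallelogram u v : S u -> S v ->
    b (u - v) (u - v) = 2 * J u + 2 * J v - 4 * J (2^-1 *: (u + v)).
  move=> Su Sv; have Suv := subspaceD Su Sv.
  have -> : 2^-1 *: (u + v) = 2^-1 *: (u + v) + 0 by rewrite addr0.
  have b0 w : S w -> b w 0 = 0.
    move=> Sw; rewrite psd_sym -(subrr w) (linear_onB (psd_linear Sw))//.
    by rewrite subrr.
  have S0 := subspace0.
  rewrite /J psd_square// !b0// l_lin//.
  have l0 : l 0 = 0 by rewrite -(subrr 0) (linear_onB l_lin)// subrr.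
  have -> : u - v = -1 *: v + u by rewrite scaleN1r addrC.
  have -> : u + v = 1 *: u + v by rewrite scale1r.
  rewrite l0 !psd_square// (psd_sym v u) scale1r (linear_onD l_lin)//.
  by field.
have v_cauchy n k : (n <= k)%N ->
    b (v_ n - v_ k) (v_ n - v_ k) <= 4^-1 ^+ n.
  move=> nk; rewrite parallelogram//.
  have Jmid := mJ _ (subspaceZ 2^-1 (subspaceD (Sv_ n) (Sv_ k))).
  have [_ Jn] := v_min n; have [_ Jk] := v_min k.
  have ek : (4^-1 ^+ k : R) <= 4^-1 ^+ n.
    by rewrite ler_wiXn2l// ?invr_ge0 ?invf_le1 ?ler1n.
  by lra.
have [u Su v_u] := complete_b v_ Sv_ v_cauchy.
exists u => // w Sw.
have residual n : (b (v_ n) w - l w) ^+ 2 <= b w w * 4^-1 ^+ n.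
  apply: quadratic_ge0_disc => [|t]; first exact: psd_ge0.
  have /mJ := subspaceP t Sw (Sv_ n); rewrite /J psd_square// l_lin//.
  have [_] := v_min n; rewrite /J.
  have : 0 <= 4^-1 ^+ n :> R by rewrite exprn_ge0// invr_ge0.
  rewrite (psd_sym w); move: (_ ^+ n) => e.
  by rewrite !mulrDr !mulrDl !mulrN; lra.
have bound n : (b u w - l w) ^+ 2 <=
    2 * b w w * b (v_ n - u) (v_ n - u) + 2 * b w w * 4^-1 ^+ n.
  have := psd_cauchy_schwarz (subspaceB (Sv_ n) Su) Sw.
  have := residual n.
  rewrite (linear_onB (psd_linear Sw))//; move: (b (_ - _) _) => e.
  have := sqr_ge0 (b (v_ n) w - l w + (b (v_ n) w - b u w)).
  by move: (_ ^+ n) (b (v_ n) w) => ? ?; nra.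
have rhs_cvg : (2 * b w w * b (v_ n - u) (v_ n - u) +
    2 * b w w * 4^-1 ^+ n) @[n --> \oo] --> (0 : R).
  rewrite -(addr0 0); apply: cvgD; rewrite -(mulr0 (2 * b w w)).
    exact: cvgMl_tmp.
  by apply: cvgMl_tmp; apply: cvg_expr; rewrite ger0_norm ?invr_ge0 ?invf_lt1 ?ltr1n.
have : (b u w - l w) ^+ 2 <= 0.
  rewrite -(cvg_lim _ rhs_cvg)//; apply: limr_ge; last exact: nearW.
  by apply/cvg_ex; exists 0.
by rewrite le_eqVlt ltNge sqr_ge0 orbF sqrf_eq0 subr_eq0 => /eqP.
Qed.

End psd_form.

(** * Iterated integrals against the kernel *)

Section iterated_integral.
Context (R : realType) (d : nat).
Context (lambda : {measure set Rd R d -> \bar R}) (Omega : set (Rd R d)).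
Context (K : R.-sigmafker Rd R d ~> Rd R d).
Context (mOmega : measurable Omega) (K_nondeg : nondegenerate_kernel K).
Local Notation X := (Rd R d).
Implicit Types (F G : X * X -> R).

Definition inner F x : \bar R := (\int[K x]_y (F (x, y))%:E)%E.

Definition iterated F : \bar R := (\int[lambda]_(x in Omega) inner F x)%E.

Definition iterated_integrable F :=
  measurable_fun setT F /\ (iterated (fun z => `|F z|%R) < +oo)%E.

Lemma measurable_slice F x :
  measurable_fun setT F -> measurable_fun setT (fun y => (F (x, y))%:E).
Proof.
by move=> mF; apply/measurable_EFinP; exact: measurableT_comp.
Qed.

Lemma measurable_inner F : measurable_fun setT F -> measurable_fun setT (inner F).
Proof.
move=> mF.
have -> : inner F = (fun x =>
    \int[K x]_y (Num.max (F (x, y)) 0)%:E - \int[K x]_y (Num.max (- F (x, y)) 0)%:E)%E.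
  by apply/funext => x; rewrite /inner integralE; congr (_ - _)%E;
    apply: eq_integral => y _; rewrite ?funeposE ?funenegE -?EFinN -EFin_max.
apply: emeasurable_funB.
- apply: (K_nondeg (f := fun z => Num.max (F z) 0)) => [|z].
    by apply: measurable_maxr.
  by rewrite le_max lexx orbT.
- apply: (K_nondeg (f := fun z => Num.max (- F z) 0)) => [|z].
    by apply: measurable_maxr => //; exact: measurableT_comp.
  by rewrite le_max lexx orbT.
Qed.

Lemma inner_ge0 F x : (forall z, 0 <= F z) -> (0 <= inner F x)%E.
Proof. by move=> F0; apply: integral_ge0 => y _; rewrite lee_fin. Qed.

Lemma iterated_ge0 F : (forall z, 0 <= F z) -> (0 <= iterated F)%E.
Proof. by move=> F0; apply: integral_ge0 => x _; exact: inner_ge0. Qed.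

Lemma le_iterated F G : measurable_fun setT F -> measurable_fun setT G ->
  (forall z, 0 <= F z <= G z) -> (iterated F <= iterated G)%E.
Proof.
move=> mF mG FG.
have F0 z : 0 <= F z by have /andP[] := FG z.
have G0 z : 0 <= G z by have /andP[/le_trans] := FG z; apply.
apply: ge0_le_integral => //.
- by move=> x _; exact: inner_ge0.
- by apply: measurable_funTS; exact: measurable_inner.
- by apply: measurable_funTS; exact: measurable_inner.
- move=> x _; apply: ge0_le_integral => //.
  + by move=> y _; rewrite lee_fin.
  + exact: measurable_slice.
  + exact: measurable_slice.
  + by move=> y _; rewrite lee_fin; have /andP[] := FG (x, y).
Qed.

Lemma measurable_normF F : measurable_fun setT F ->
  measurable_fun setT (fun z => `|F z|).
Proof. by move=> mF; exact: measurableT_comp. Qed.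

Lemma iterated_integrable_ae F : iterated_integrable F ->
  {ae lambda, forall x, Omega x -> (K x).-integrable setT (fun y => (F (x, y))%:E)}.
Proof.
move=> [mF Foo].
have : lambda.-integrable Omega (inner (fun z => `|F z|)).
  apply/integrableP; split.
    by apply: measurable_funTS; apply: measurable_inner; exact: measurable_normF.
  rewrite (eq_integral (inner (fun z => `|F z|)))// => x _.
  by rewrite gee0_abs// inner_ge0.
move=> /(integrable_ae mOmega); apply: filterS => x Ix Ox.
apply/integrableP; split; first exact: measurable_slice.
by have := Ix Ox; rewrite ge0_fin_numE// inner_ge0.
Qed.

Lemma integrable_inner F : iterated_integrable F ->
  lambda.-integrable Omega (inner F).
Proof.
move=> [mF Foo]; apply/integrableP; split.
  by apply: measurable_funTS; exact: measurable_inner.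
apply: le_lt_trans Foo; apply: ge0_le_integral => //.
- by apply: measurableT_comp => //; apply: measurable_funTS; exact: measurable_inner.
- by apply: measurable_funTS; apply: measurable_inner; exact: measurable_normF.
- move=> x _; apply: (le_trans (le_abse_integral _ _ _)) => //.
  exact: measurable_slice.
Qed.

Lemma iterated_integrable_le F G : measurable_fun setT F ->
  (forall z, `|F z| <= G z) -> iterated_integrable G -> iterated_integrable F.
Proof.
move=> mF FG [mG Goo]; split => //; apply: le_lt_trans Goo; apply: le_iterated.
- exact: measurable_normF.
- exact: measurable_normF.
- by move=> z; rewrite normr_ge0 (le_trans (FG z))// ler_norm.
Qed.

(** The inner integrals of a signed function may be infinite for [x] in a
    [lambda]-null set, so that they add up only almost everywhere. *)
Lemma iterated_linear (a : R) F G :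
  iterated_integrable F -> iterated_integrable G ->
  iterated_integrable (fun z => a * F z + G z) /\
  fine (iterated (fun z => a * F z + G z)) =
    a * fine (iterated F) + fine (iterated G).
Proof.
move=> iF iG; have [mF Foo] := iF; have [mG Goo] := iG.
have mH : measurable_fun setT (fun z => a * F z + G z).
  by apply: measurable_funD => //; exact: measurable_funM.
have lin (a' : R) F' G' : iterated_integrable F' -> iterated_integrable G' ->
    measurable_fun setT (fun z => a' * F' z + G' z) ->
    iterated (fun z => a' * F' z + G' z) = (a'%:E * iterated F' + iterated G')%E.
  move=> iF' iG' mH'.
  have JF := integrable_inner iF'; have JG := integrable_inner iG'.
  rewrite /iterated -integralZl// -integralD//; last exact: integrableZl.
  apply: ae_eq_integral => //.
  - by apply: measurable_funTS; exact: measurable_inner.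
  - apply: emeasurable_funD; last exact: measurable_int JG.
    by apply: measurable_funeM; exact: measurable_int JF.
  - apply: filterS2 (iterated_integrable_ae iF') (iterated_integrable_ae iG').
    move=> x Fx Gx Ox; have {}Fx := Fx Ox; have {}Gx := Gx Ox.
    by rewrite /inner -integralZl// -integralD//; exact: integrableZl.
have iH : iterated_integrable (fun z => a * F z + G z).
  have absI F' : iterated_integrable F' -> iterated_integrable (fun z => `|F' z|).
    move=> [mF' Foo']; split; first exact: measurable_normF.
    by under eq_fun do rewrite normr_id.
  apply: (@iterated_integrable_le _ (fun z => `|a| * `|F z| + `|G z|)) => //.
    by move=> z; rewrite (le_trans (ler_normD _ _))// normrM.
  have mA : measurable_fun setT (fun z => `|a| * `|F z| + `|G z|).
    apply: measurable_funD; last exact: measurable_normF.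
    by apply: measurable_funM => //; exact: measurable_normF.
  split => //.
  under eq_fun do rewrite ger0_norm ?addr_ge0 ?mulr_ge0//.
  rewrite lin//; [|exact: absI|exact: absI].
  by apply: lte_add_pinfty => //; apply: lte_mul_pinfty; rewrite ?lee_fin.
split => //; rewrite lin//.
have iterated_fin F' : iterated_integrable F' -> iterated F' \is a fin_num.
  by move=> iF'; apply: integrable_fin_num => //; exact: integrable_inner.
by rewrite fineD ?fineM ?fin_numM ?iterated_fin.
Qed.

End iterated_integral.

(** * The space of finite energy functions and its forms *)

Section energy_forms.
Context (R : realType) (d : nat).
Context (lambda : {measure set Rd R d -> \bar R}) (Omega : set (Rd R d)).
Context (K : R.-sigmafker Rd R d ~> Rd R d).
Context (mOmega : measurable Omega) (K_nondeg : nondegenerate_kernel K).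
Local Notation X := (Rd R d).
Local Notation iterated := (iterated lambda Omega K).
Local Notation iterated_integrable := (iterated_integrable lambda Omega K).
Local Notation L2 := (L2 lambda Omega).
Local Notation calV := (calV lambda Omega K).
Implicit Types (u v w : X -> R) (rho : X * X -> R).

Definition L2form u v := fine (\int[lambda]_(x in Omega) (u x * v x)%:E)%E.

(** For [rho = 1] this is the bilinear form of the seminorm of [calV]; for
    [rho] equal to [energy_weight] below it is [Bform]. *)
Definition weighted_form rho u v :=
  fine (iterated (fun z => rho z * ((u z.1 - u z.2) * (v z.1 - v z.2)))).

Definition Vform u v := L2form u v + weighted_form (cst 1) u v.

Definition weight rho := measurable_fun setT rho /\ forall z, 0 <= rho z <= 1.

Lemma weight1 : weight (cst 1).
Proof. by split => [|z /=]; [exact: measurable_cst|rewrite ler01 lexx]. Qed.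

Lemma normrM_le_sqrD (a b : R) : `|a * b| <= a ^+ 2 + b ^+ 2.
Proof.
rewrite normrM -(real_normK (num_real a)) -(real_normK (num_real b)).
by have := normr_ge0 a; have := normr_ge0 b; nra.
Qed.

Lemma L2_integrable u v : L2 u -> L2 v ->
  lambda.-integrable Omega (fun x => (u x * v x)%:E).
Proof.
move=> [mu uoo] [mv voo].
have sq_int w : measurable_fun Omega w ->
    (\int[lambda]_(x in Omega) (w x ^+ 2)%:E < +oo)%E ->
    lambda.-integrable Omega (fun x => (w x ^+ 2)%:E).
  move=> mw woo; apply/integrableP; split.
    by apply/measurable_EFinP; exact: measurable_funX.
  by under eq_integral do rewrite gee0_abs ?lee_fin ?sqr_ge0//.
apply: (le_integrable mOmega _ _
  (integrableD mOmega (sq_int _ mu uoo) (sq_int _ mv voo))).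
- by apply/measurable_EFinP; exact: measurable_funM.
- move=> x _; rewrite -EFinD !abse_EFin lee_fin.
  by rewrite (le_trans (normrM_le_sqrD _ _))// ler_norm.
Qed.

Lemma L2_subspace : subspace L2.
Proof.
split.
  split; first exact: measurable_cst.
  under eq_integral do rewrite expr0n/=.
  by rewrite integral0.
move=> a u v Lu Lv; split.
  apply: measurable_funD; last by case: Lv.
  by apply: measurable_funM; [exact: measurable_cst|case: Lu].
have -> : (fun x => ((a *: u + v) x ^+ 2)%:E) =
   ((fun x => (a ^+ 2)%:E * (u x * u x)%:E) \+
    ((fun x => (2 * a)%:E * (u x * v x)%:E) \+ (fun x => (v x * v x)%:E)))%E.
  apply/funext => x; rewrite /= -!EFinM -!EFinD; congr _%:E.
  rewrite (_ : (a *: u + v) x = a * u x + v x)//; ring.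
have := integrable_lty (mu := lambda) (D := Omega); apply => //.
have [iuu iuv ivv] := And3 (L2_integrable Lu Lu) (L2_integrable Lu Lv)
  (L2_integrable Lv Lv).
by do 2?[apply: integrableD => //; first exact: integrableZl].
Qed.

Lemma L2form_psd : psd_form L2 L2form.
Proof.
split.
- move=> w Lw a u v Lu Lv; rewrite /L2form.
  have iu := L2_integrable Lu Lw; have iv := L2_integrable Lv Lw.
  transitivity (fine (a%:E * \int[lambda]_(x in Omega) (u x * w x)%:E +
      \int[lambda]_(x in Omega) (v x * w x)%:E))%E.
    rewrite -integralZl// -integralD//; last exact: integrableZl.
    congr fine; apply: eq_integral => x _; rewrite -EFinM -EFinD; congr _%:E.
    by rewrite (_ : (a *: u + v) x = a * u x + v x)//; ring.
  have fu := integrable_fin_num mOmega iu.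
  have fv := integrable_fin_num mOmega iv.
  by rewrite fineD ?fineM ?fin_numM.
- by move=> u v; congr fine; apply: eq_integral => x _; rewrite mulrC.
- move=> u Lu; apply/fine_ge0/integral_ge0 => x _.
  by rewrite lee_fin -expr2 sqr_ge0.
Qed.

Lemma L2form_norm u : form_norm L2form u = L2norm lambda Omega u.
Proof. by []. Qed.

Lemma measurable_diff u : measurable_fun setT u ->
  measurable_fun setT (fun z : X * X => u z.1 - u z.2).
Proof.
move=> mu; apply: measurable_funB.
  exact: (measurableT_comp mu measurable_fst).
exact: (measurableT_comp mu measurable_snd).
Qed.

Definition sqr_diff u (z : X * X) := (u z.1 - u z.2) ^+ 2.

Lemma calVP u : calV u <->
  [/\ measurable_fun setT u, L2 u & iterated_integrable (sqr_diff u)].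
Proof.
have L0 : (0 <= \int[lambda]_(x in Omega) (u x ^+ 2)%:E)%E.
  by apply: integral_ge0 => x _; rewrite lee_fin sqr_ge0.
have I0 : (0 <= iterated (sqr_diff u))%E.
  by apply: iterated_ge0 => z; rewrite sqr_ge0.
have normsq : (fun z => `|sqr_diff u z|) = sqr_diff u.
  by apply/funext => z; rewrite ger0_norm ?sqr_ge0.
split => [[mu uoo]|[mu [_ Loo] [_ Ioo]]].
  split => //; split => //.
  - exact: measurable_funTS.
  - by apply: le_lt_trans uoo; rewrite leeDl.
  - by apply: measurable_funX; exact: measurable_diff.
  - by apply: le_lt_trans uoo; rewrite normsq leeDr.
split; first exact: mu.
by apply: lte_add_pinfty; [exact: Loo|rewrite normsq in Ioo; exact: Ioo].
Qed.

Lemma calV_measurable u : calV u -> measurable_fun setT u.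
Proof. by case. Qed.

Lemma calV_L2 u : calV u -> L2 u. Proof. by case/calVP. Qed.

Lemma weighted_integrable rho u v : weight rho -> calV u -> calV v ->
  iterated_integrable (fun z => rho z * ((u z.1 - u z.2) * (v z.1 - v z.2))).
Proof.
move=> [mrho rho1] /calVP[mu _ Iu] /calVP[mv _ Iv].
have [I _] := iterated_linear mOmega K_nondeg 1 Iu Iv.
apply: (iterated_integrable_le mOmega K_nondeg) I => //.
  apply: measurable_funM => //.
  by apply: measurable_funM; exact: measurable_diff.
move=> z; rewrite mul1r normrM.
have /andP[r0 r1] := rho1 z; rewrite (ger0_norm r0).
apply: (le_trans _ (normrM_le_sqrD _ _)).
by rewrite ler_piMl.
Qed.

Lemma calV_subspace : subspace calV.
Proof.
split.
  apply/calVP; split; [exact: measurable_cst|exact: L2_subspace.1|].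
  split.
    by apply: measurable_funX; apply: measurable_diff; exact: measurable_cst.
  rewrite /iterated /inner.
  under eq_integral do under eq_integral do
    rewrite /sqr_diff subrr expr0n/= normr0.
  by under eq_integral do rewrite integral0; rewrite integral0.
move=> a u v Vu Vv; apply/calVP; split.
- apply: measurable_funD; last by case: Vv.
  by apply: measurable_funM; [exact: measurable_cst|case: Vu].
- exact: L2_subspace.2 (calV_L2 Vu) (calV_L2 Vv).
- have [I _] := iterated_linear mOmega K_nondeg (a ^+ 2)
    (weighted_integrable weight1 Vu Vu)
    (iterated_linear mOmega K_nondeg (2 * a) (weighted_integrable weight1 Vu Vv)
      (weighted_integrable weight1 Vv Vv)).1.
  suff -> : sqr_diff (a *: u + v) = (fun z => a ^+ 2 * (cst 1 z * ((u z.1 - u z.2) *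
      (u z.1 - u z.2))) + (2 * a * (cst 1 z * ((u z.1 - u z.2) * (v z.1 - v z.2)))
      + cst 1 z * ((v z.1 - v z.2) * (v z.1 - v z.2)))) by [].
  apply/funext => z; rewrite /sqr_diff /=.
  have E x : (a *: u + v) x = a * u x + v x by [].
  by rewrite !E; ring.
Qed.

Lemma weighted_form_psd rho : weight rho -> psd_form calV (weighted_form rho).
Proof.
move=> Wrho; split.
- move=> w Vw a u v Vu Vv; rewrite /weighted_form.
  have [_ <-] := iterated_linear mOmega K_nondeg a
    (weighted_integrable Wrho Vu Vw) (weighted_integrable Wrho Vv Vw).
  congr (fine (iterated _)); apply/funext => z.
  have E x : (a *: u + v) x = a * u x + v x by [].
  by rewrite !E; ring.
- by move=> u v; congr (fine (iterated _)); apply/funext => z; ring.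
- move=> u Vu; apply/fine_ge0/iterated_ge0 => z.
  have [_ /(_ z) /andP[r0 _]] := Wrho.
  by rewrite mulr_ge0// -expr2 sqr_ge0.
Qed.

Lemma weighted_form_le (rho rho' : X * X -> R) (c : R) u :
  weight rho -> weight rho' -> 0 <= c -> (forall z, rho z <= c * rho' z) -> calV u ->
  weighted_form rho u u <= c * weighted_form rho' u u.
Proof.
move=> Wr Wr' c0 rr' Vu.
have Ir := weighted_integrable Wr Vu Vu; have Ir' := weighted_integrable Wr' Vu Vu.
have [Ic] := iterated_linear mOmega K_nondeg (c - 1) Ir' Ir'.
rewrite mulrBl mul1r subrK => <-.
have fin F : iterated_integrable F -> iterated F \is a fin_num.
  by move=> IF; apply: integrable_fin_num => //; exact: integrable_inner.
apply: fine_le; [exact: fin|exact: fin|].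
apply: (le_iterated _ mOmega K_nondeg); [exact: Ir.1|exact: Ic.1|move=> z].
rewrite -expr2; have s0 := sqr_ge0 (u z.1 - u z.2).
have [_ /(_ z) /andP[r0 _]] := Wr.
move: (_ ^+ 2) s0 => s s0; rewrite mulr_ge0//=.
rewrite (_ : _ + _ = c * rho' z * s); last by ring.
by rewrite ler_wpM2r.
Qed.

Lemma Vform_psd : psd_form calV Vform.
Proof.
have [l1 s1 p1] := L2form_psd; have [l2 s2 p2] := weighted_form_psd weight1.
split.
- move=> w Vw a u v Vu Vv.
  have E1 : L2form (a *: u + v) w = a * L2form u w + L2form v w.
    by apply: l1; exact: calV_L2.
  have E2 : weighted_form (cst 1) (a *: u + v) w =
      a * weighted_form (cst 1) u w + weighted_form (cst 1) v w by exact: l2.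
  by rewrite /Vform E1 E2 mulrDr addrACA.
- by move=> u v; rewrite /Vform s1 s2.
- by move=> u Vu; rewrite addr_ge0 ?p1 ?p2//; exact: calV_L2.
Qed.

Lemma Vnorm_sqE u : calV u -> Vnorm_sq lambda Omega K u = (Vform u u)%:E.
Proof.
move=> Vu; have /calVP[mu Lu Iu] := Vu.
have fL := integrable_fin_num mOmega (L2_integrable Lu Lu).
have fI := integrable_fin_num mOmega (integrable_inner mOmega K_nondeg
  (weighted_integrable weight1 Vu Vu)).
rewrite /Vform /L2form /weighted_form EFinD (fineK fL) (fineK fI).
congr (_ + _)%E.
by apply: eq_integral => x _; apply: eq_integral => y _; rewrite mul1r expr2.
Qed.

Lemma form_norm_Vform u : calV u -> form_norm Vform u = Vnorm lambda Omega K u.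
Proof. by move=> Vu; rewrite /Vnorm (Vnorm_sqE Vu). Qed.

(** Pairs of points of [Omega] are counted twice by the outer integral over
    [Omega], hence the halved weight. *)
Definition energy_weight (z : X * X) : R := 2^-1 * \1_Omega z.2 + \1_(~` Omega) z.2.

Lemma energy_weight_bounds z : 2^-1 <= energy_weight z <= 1.
Proof.
rewrite /energy_weight !indicE in_setC.
by case: (z.2 \in Omega) => /=; rewrite ?mulr1 ?mulr0 ?add0r ?addr0; lra.
Qed.

Lemma energy_weightP : weight energy_weight.
Proof.
split; last first.
  by move=> z; have /andP[h ->] := energy_weight_bounds z; rewrite andbT; lra.
have mcomp A : measurable A -> measurable_fun setT (fun z : X * X => \1_A z.2 : R).
  move=> mA; apply: (measurableT_comp _ measurable_snd).
  exact: measurable_indic.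
apply: measurable_funD; last by apply: mcomp; exact: measurableC.
by apply: measurable_funM => //; exact: mcomp.
Qed.

Lemma Bform_weighted u v : calV u -> calV v ->
  Bform lambda Omega K u v = weighted_form energy_weight u v.
Proof.
move=> Vu Vv.
have cutE A : measurable A ->
    (\int[lambda]_(x in Omega) \int[K x]_(y in A) ((u x - u y) * (v x - v y))%:E =
     iterated (fun z => \1_A z.2 * ((u z.1 - u z.2) * (v z.1 - v z.2)))%R)%E.
  move=> mA; apply: eq_integral => x _; rewrite integral_mkcond.
  apply: eq_integral => y _; rewrite patchE /= indicE.
  by case: (y \in A); rewrite ?mul1r ?mul0r.
have Wcut A : measurable A -> weight (fun z : X * X => \1_A z.2 : R).
  move=> mA; split; last by move=> z; rewrite indicE ler0n lern1 leq_b1.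
  apply: (measurableT_comp _ measurable_snd); exact: measurable_indic.
have mC : measurable (~` Omega) by exact: measurableC.
rewrite /Bform !cutE//.
have [_ <-] := iterated_linear mOmega K_nondeg 2^-1
  (weighted_integrable (Wcut _ mOmega) Vu Vv)
  (weighted_integrable (Wcut _ mC) Vu Vv).
congr (fine (iterated _)); apply/funext => z; rewrite /energy_weight.
by ring.
Qed.

End energy_forms.

(** * Null sets and the symmetry of the kernel *)

Lemma measurable_neq_fun (d : measure_display) (T : measurableType d)
    (R : realType) (u v : T -> R) :
  measurable_fun setT u -> measurable_fun setT v ->
  measurable [set x | u x != v x].
Proof.
move=> mu mv; rewrite (_ : [set _ | _] = setT `&` [set x | (u x == v x) = false]).
  by apply: (measurable_fun_eqr mu mv measurableT (Y := [set false])).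
by apply/seteqP; split => x /=; [move/negbTE|case=> _ /negbT].
Qed.

Section null_sets.
Context (R : realType) (d : nat).
Context (lambda : {measure set Rd R d -> \bar R}) (Omega : set (Rd R d)).
Context (K : R.-sigmafker Rd R d ~> Rd R d).
Context (mOmega : measurable Omega) (K_nondeg : nondegenerate_kernel K)
  (K_sym : kernel_symmetric lambda K).
Local Notation X := (Rd R d).
Local Notation Gamma := (Gamma Omega K).
Local Notation iterated := (iterated lambda Omega K).
Local Notation L2 := (L2 lambda Omega).
Local Notation calV := (calV lambda Omega K).
Local Notation calV0 := (calV0 lambda Omega K).
Local Notation V0 := (V0 lambda Omega K).
Local Notation Veq := (Veq lambda Omega K).
Local Notation extends := (extends lambda Omega K).
Implicit Types (N : set X) (u v w : X -> R) (F G : X * X -> R).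

Lemma measurable_Gamma : measurable Gamma.
Proof.
rewrite (_ : Gamma = ~` Omega `&` [set y | (0 < K y Omega)%E]); last first.
  by apply/seteqP; split => y [].
apply: measurableI; first exact: measurableC.
rewrite -[X in measurable X]setTI; apply: emeasurable_fun_o_infty => //.
exact: measurable_kernel.
Qed.

Lemma measurable_OmegaUGamma : measurable (Omega `|` Gamma).
Proof. by apply: measurableU => //; exact: measurable_Gamma. Qed.

(** On a rectangle both sides of the symmetry of the kernel reduce to a single
    integral: the mass sent from one side to the other. *)
Lemma kernel_symmetric_setX (A B : set X) : measurable A -> measurable B ->
  (\int[lambda]_(x in A) K x B = \int[lambda]_(x in B) K x A)%E.
Proof.
move=> mA mB; have := K_sym (measurableX mA mB).
have inE' (a b : X) : (\1_(A `*` B) (a, b) : R) = \1_A a * \1_B b.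
  by rewrite !indicE in_setX -natrM mulnb.
under eq_integral => x _.
  under eq_integral do rewrite inE' EFinM.
  rewrite ge0_integralZl//; [|exact/measurable_EFinP/measurable_indic].
  rewrite integral_indic// setIT.
  over.
under [in RHS]eq_integral => y _.
  under eq_integral do rewrite inE' mulrC EFinM.
  rewrite ge0_integralZl//; [|exact/measurable_EFinP/measurable_indic].
  rewrite integral_indic// setIT.
  over.
move=> sym; rewrite integral_mkcond [RHS]integral_mkcond.
have patch_indic (C : set X) (f : X -> \bar R) : f \_ C = (fun x => (\1_C x)%:E * f x)%E.
  apply/funext => x; rewrite patchE indicE.
  by case: (x \in C); rewrite ?mul1e ?mul0e.
by rewrite !patch_indic.
Qed.

(** The mass that [Omega] sends to [N] is the mass that [N] sends to [Omega],
    and off [Omega `|` Gamma] no mass is sent to [Omega]. *)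
Lemma null_kernel N : measurable N -> lambda (N `&` (Omega `|` Gamma)) = 0 ->
  {ae lambda, forall x, Omega x -> K x N = 0}.
Proof.
move=> mN N0.
have mK A D : measurable A -> measurable_fun D (fun x => K x A).
  by move=> mA; apply: measurable_funTS; exact: measurable_kernel.
have : (\int[lambda]_(x in Omega) `|K x N| = 0)%E.
  under eq_integral do rewrite gee0_abs//.
  rewrite kernel_symmetric_setX//.
  rewrite (ge0_ae_eq_integral _ _ (g := cst 0)%E) ?integral0//; first exact: mK.
  exists (N `&` (Omega `|` Gamma)); split => //.
    by apply: measurableI => //; exact: measurable_OmegaUGamma.
  move=> y /= /not_implyP[Ny Ky]; split => //.
  have [Oy|Oy] := pselect (Omega y); first by left.
  by right; split => //; rewrite lt0e measure_ge0 andbT; exact/eqP.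
by move=> /(ae_eq_integral_abs lambda mOmega (mK N Omega mN)).
Qed.

Lemma ae_eq_in_null (D : set X) u v : measurable D ->
  measurable_fun setT u -> measurable_fun setT v ->
  u = v %[ae lambda in D] ->
  measurable [set x | u x != v x] /\ lambda ([set x | u x != v x] `&` D) = 0.
Proof.
move=> mD mu mv uv; have mN := measurable_neq_fun mu mv.
split => //; have [N [mN' N0 sub]] := uv.
apply: (subset_measure0 _ mN' _ N0); first exact: measurableI.
by move=> x [/= /eqP ux Dx]; apply: sub => /= /(_ Dx).
Qed.

(** Within a class of [V] a function changes only on a set that, by
    [null_kernel], the inner integrals do not see. *)
Lemma Veq_kernel_ae u v : measurable_fun setT u -> measurable_fun setT v ->
  Veq u v -> {ae lambda, forall x, Omega x -> u x = v x /\ u = v %[ae K x]}.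
Proof.
move=> mu mv uv.
have [mN N0] := ae_eq_in_null measurable_OmegaUGamma mu mv uv.
apply: filterS2 uv (null_kernel mN N0) => x ux Kx Ox; split.
  by apply: ux; left.
exists [set x | u x != v x]; split => //; first exact: Kx.
by move=> y /= /not_implyP[_ /eqP].
Qed.

Lemma iterated_ae_eq F G : measurable_fun setT F -> measurable_fun setT G ->
  {ae lambda, forall x, Omega x -> {ae K x, forall y, F (x, y) = G (x, y)}} ->
  iterated F = iterated G.
Proof.
move=> mF mG FG; apply: ae_eq_integral => //.
- by apply: measurable_funTS; exact: measurable_inner.
- by apply: measurable_funTS; exact: measurable_inner.
- apply: filterS FG => x FGx Ox; apply: ae_eq_integral => //.
  + exact: measurable_slice.
  + exact: measurable_slice.
  + by apply: filterS (FGx Ox) => y ->.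
Qed.

Lemma Veq_refl u : Veq u u. Proof. exact: nearW. Qed.

Lemma Veq_sym u v : Veq u v -> Veq v u.
Proof. by apply: filterS => x uv Dx; rewrite uv. Qed.

Lemma weighted_form_Veq rho u u' v v' : weight rho ->
  calV u -> calV u' -> calV v -> calV v' -> Veq u u' -> Veq v v' ->
  weighted_form lambda Omega K rho u v = weighted_form lambda Omega K rho u' v'.
Proof.
move=> Wrho Vu Vu' Vv Vv' uu' vv'; rewrite /weighted_form.
congr fine; apply: iterated_ae_eq.
- exact: (weighted_integrable mOmega K_nondeg Wrho Vu Vv).1.
- exact: (weighted_integrable mOmega K_nondeg Wrho Vu' Vv').1.
- have ae_u := Veq_kernel_ae (calV_measurable Vu) (calV_measurable Vu') uu'.
  have ae_v := Veq_kernel_ae (calV_measurable Vv) (calV_measurable Vv') vv'.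
  apply: filterS2 ae_u ae_v => x Ux Vx Ox.
  have [ux Uy] := Ux Ox; have [vx Vy] := Vx Ox.
  by apply: filterS2 Uy Vy => y /= /(_ I) uy /(_ I) vy; rewrite ux uy vx vy.
Qed.

Lemma Vnorm_sq_Veq u v : measurable_fun setT u -> measurable_fun setT v ->
  Veq u v -> Vnorm_sq lambda Omega K u = Vnorm_sq lambda Omega K v.
Proof.
move=> mu mv uv; rewrite /Vnorm_sq; congr (_ + _)%E.
  apply: ae_eq_integral => //.
  - by apply/measurable_EFinP; apply: measurable_funX; exact: measurable_funTS.
  - by apply/measurable_EFinP; apply: measurable_funX; exact: measurable_funTS.
  - by apply: filterS uv => x ux Ox; rewrite ux//; left.
apply: (@iterated_ae_eq (sqr_diff u) (sqr_diff v)).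
- by apply: measurable_funX; exact: measurable_diff.
- by apply: measurable_funX; exact: measurable_diff.
- apply: filterS (Veq_kernel_ae mu mv uv) => x Ux Ox.
  have [ux uy] := Ux Ox.
  by apply: filterS uy => y /= uy; rewrite /sqr_diff /= ux uy.
Qed.

Lemma calV_Veq u v : measurable_fun setT u -> calV v -> Veq u v -> calV u.
Proof.
move=> mu [mv voo] uv; split; first exact: mu.
by rewrite (Vnorm_sq_Veq mu mv uv); exact: voo.
Qed.

(** If the double integral of [(u x - u y) ^ 2] over [Omega * R^d] vanishes, its
    mirror image shows that at almost every point [y] of [Gamma] the value [u y]
    is taken [K y]-almost everywhere on [Omega], a set that [K y] charges. *)
Lemma Vnorm_sq0_Veq u : calV u -> Vnorm_sq lambda Omega K u = 0%E -> Veq u (cst 0).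
Proof.
move=> Vu u0; have mu := calV_measurable Vu.
have sq0 x : (0 <= (u x ^+ 2)%:E :> \bar R)%E by rewrite lee_fin sqr_ge0.
have sqd0 z : 0 <= sqr_diff u z by rewrite sqr_ge0.
have msqd : measurable_fun setT (sqr_diff u).
  by apply: measurable_funX; exact: measurable_diff.
have [L0 I0] : (\int[lambda]_(x in Omega) (u x ^+ 2)%:E = 0 /\
    iterated (sqr_diff u) = 0)%E.
  have L0 : (0 <= \int[lambda]_(x in Omega) (u x ^+ 2)%:E)%E.
    by apply: integral_ge0 => x _.
  have I0 : (0 <= iterated (sqr_diff u))%E by exact: iterated_ge0.
  by move/eqP: u0; rewrite (padde_eq0 L0 I0) => /andP[/eqP-> /eqP].
have u_Omega : u = cst 0 %[ae lambda in Omega].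
  have mu2 : measurable_fun Omega (fun x => (u x ^+ 2)%:E).
    by apply/measurable_EFinP; apply: measurable_funX; exact: measurable_funTS.
  have /(ae_eq_integral_abs lambda mOmega mu2) :
      (\int[lambda]_(x in Omega) `|(u x ^+ 2)%:E| = 0)%E.
    by under eq_integral do rewrite gee0_abs//.
  by apply: filterS => x + Ox => /(_ Ox) /= [] /eqP; rewrite sqrf_eq0 => /eqP.
have kernel_Omega : {ae lambda, forall x, Omega x -> u = cst (u x) %[ae K x]}.
  have mI : measurable_fun Omega (inner K (sqr_diff u)).
    by apply: measurable_funTS; exact: measurable_inner.
  have /(ae_eq_integral_abs lambda mOmega mI) :
      (\int[lambda]_(x in Omega) `|inner K (sqr_diff u) x| = 0)%E.
    by under eq_integral do rewrite gee0_abs ?inner_ge0//.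
  apply: filterS => x + Ox => /(_ Ox) /= Ix.
  have mx := measurable_slice x msqd.
  have /(ae_eq_integral_abs (K x) measurableT mx) :
      (\int[K x]_y `|(sqr_diff u (x, y))%:E| = 0)%E.
    by under eq_integral do rewrite gee0_abs ?lee_fin ?sqd0//.
  apply: filterS => y /(_ I) [] /eqP; rewrite sqrf_eq0 subr_eq0 => /eqP ->//.
pose M : set (X * X) := [set z | Omega z.1 /\ u z.1 != u z.2].
have mM : measurable M.
  rewrite (_ : M = (Omega `*` setT) `&` [set z | u z.1 != u z.2]); last first.
    by apply/seteqP; split => z /= => [[]|[[]]].
  apply: measurableI; first exact: measurableX.
  apply: measurable_neq_fun.
    exact: (measurableT_comp mu measurable_fst).
  exact: (measurableT_comp mu measurable_snd).
have M1_0 x : Omega x -> u = cst (u x) %[ae K x] ->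
    (\int[K x]_y (\1_M (x, y))%:E = 0)%E.
  move=> Ox ux; rewrite (ae_eq_integral (cst 0)%E) ?integral0//.
    by apply: measurable_slice; exact: measurable_indic.
  apply: filterS ux => y /(_ I) /= uy _.
  by rewrite indicE memNset//= => -[_ /=]; rewrite uy eqxx.
(* The symmetry of the kernel exchanges the two variables of [M]. *)
have mirror : {ae lambda, forall y, K y [set x | Omega x /\ u x != u y] = 0}.
  have m1M : measurable_fun setT (\1_M : X * X -> R) by exact: measurable_indic.
  pose M' := (fun z => \1_M (z.2, z.1)) : X * X -> R.
  have mM' : measurable_fun setT M'.
    apply: (measurableT_comp m1M).
    by apply: measurable_fun_pair; [exact: measurable_snd|exact: measurable_fst].
  have mI' : measurable_fun setT (inner K M') by exact: measurable_inner.
  have /(ae_eq_integral_abs lambda measurableT mI') :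
      (\int[lambda]_y `|inner K M' y| = 0)%E.
    under eq_integral do rewrite gee0_abs ?inner_ge0//.
    have := K_sym mM; rewrite /inner /M' /= => <-.
    rewrite (ae_eq_integral (cst 0)%E) ?integral0//.
      by apply: (measurable_inner K_nondeg m1M).
    apply: filterS kernel_Omega => x ux _.
    have [Ox|nOx] := pselect (Omega x); first by apply: M1_0 => //; exact: ux.
    rewrite /cst integral0_eq// => y _.
    by rewrite indicE memNset// => -[].
  apply: filterS => y /(_ I); rewrite /inner /M' /= => <-.
  rewrite -(setIT [set x | _]) -integral_indic//.
  by apply: measurableI => //; exact: measurable_neq_fun.
have mNz : measurable [set x | Omega x /\ u x != 0].
  by apply: measurableI => //; exact: measurable_neq_fun.
(* A null subset of [Omega] sends no mass, so almost no point sends mass to it. *)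
have backflow : {ae lambda, forall y, K y [set x | Omega x /\ u x != 0] = 0}.
  have mK A : measurable A -> measurable_fun setT (fun x => K x A).
    by move=> mA; exact: measurable_kernel.
  have /(ae_eq_integral_abs lambda measurableT (mK _ mNz)) :
      (\int[lambda]_y `|K y [set x | Omega x /\ u x != 0%R]| = 0)%E.
    under eq_integral do rewrite gee0_abs//.
    rewrite kernel_symmetric_setX//.
    rewrite (ge0_ae_eq_integral _ _ (g := cst 0)%E) ?integral0//.
      by apply: measurable_funTS; exact: mK.
    by apply: filterS u_Omega => x /[swap] -[Ox /eqP ux] /(_ Ox).
  by apply: filterS => y /(_ I).
apply: filterS3 u_Omega mirror backflow => y uO Ky Ky0 [|[_ KyO]]; first exact: uO.
apply/eqP/negPn/negP => uy; move: KyO; apply/negP; rewrite -leNgt.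
rewrite -[leRHS](adde0 0%E) -{1}Ky -Ky0.
have mS : measurable [set x | Omega x /\ u x != u y].
  by apply: measurableI => //; exact: measurable_neq_fun.
apply: (le_trans _ (measureU2 (K y) mS mNz)).
apply: le_measure; rewrite ?inE//; first exact: measurableU.
move=> x Ox; have [ux|ux] := eqVneq (u x) 0; last by right.
by left; split => //; rewrite ux eq_sym.
Qed.

End null_sets.

(** * The space of functions vanishing on the complement *)

Section zero_data.
Context (R : realType) (d : nat).
Context (lambda : {measure set Rd R d -> \bar R}) (Omega : set (Rd R d)).
Context (K : R.-sigmafker Rd R d ~> Rd R d).
Context (mOmega : measurable Omega) (K_nondeg : nondegenerate_kernel K)
  (K_sym : kernel_symmetric lambda K).
Local Notation X := (Rd R d).
Local Notation Gamma := (Gamma Omega K).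
Local Notation L2 := (L2 lambda Omega).
Local Notation calV := (calV lambda Omega K).
Local Notation calV0 := (calV0 lambda Omega K).
Local Notation V0 := (V0 lambda Omega K).
Local Notation Veq := (Veq lambda Omega K).
Local Notation extends := (extends lambda Omega K).
Local Notation Bform := (Bform lambda Omega K).
Local Notation weak_solution := (weak_solution lambda Omega K).
Implicit Types (u v w f g : X -> R).

(** Truncating a function to [Omega] does not change its class as soon as it
    vanishes almost everywhere on [Gamma]. *)
Lemma V0P u : V0 u <-> calV u /\ extends u (cst 0).
Proof.
split=> [[Vu [w [_ w0] uw]]|[Vu u0]]; split => //.
  by apply: filterS uw => x uw Gx; rewrite uw ?w0//; [case: Gx|right].
have mu := calV_measurable Vu.
have uw : Veq u (fun x => u x * \1_Omega x).
  apply: filterS u0 => x u0 [Ox|Gx].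
    by rewrite indicE mem_set// mulr1.
  by rewrite u0// mul0r.
exists (fun x => u x * \1_Omega x); last exact: uw.
split; last first.
  by move=> x nOx; rewrite indicE memNset// mulr0.
apply: (calV_Veq mOmega K_nondeg K_sym _ Vu (Veq_sym uw)).
by apply: measurable_funM => //; exact: measurable_indic.
Qed.

Lemma calV0_subspace : subspace calV0.
Proof.
have [V00 VP] := calV_subspace lambda mOmega K_nondeg.
split; first by split.
move=> a u v [Vu u0] [Vv v0]; split; first exact: VP.
by move=> x nOx; rewrite (_ : (a *: u + v) x = a * u x + v x)// u0// v0// mulr0 addr0.
Qed.

Lemma calV0_V0 u : calV0 u -> V0 u.
Proof. by move=> u0; split; [case: u0|exists u => //; exact: Veq_refl]. Qed.

Lemma V0_calV u : V0 u -> calV u. Proof. by case. Qed.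

Lemma V0_subspace : subspace V0.
Proof.
have [V00 VP] := calV_subspace lambda mOmega K_nondeg.
split; first by apply: calV0_V0; exact: calV0_subspace.1.
move=> a u v /V0P[Vu u0] /V0P[Vv v0]; apply/V0P; split; first exact: VP.
apply: filterS2 u0 v0 => x u0 v0 Gx.
by rewrite (_ : (a *: u + v) x = a * u x + v x)// u0// v0//= mulr0 addr0.
Qed.

Lemma V0B u v g : calV u -> calV v -> extends u g -> extends v g -> V0 (u - v).
Proof.
move=> Vu Vv ug vg; apply/V0P; split.
  exact: (subspaceB (calV_subspace lambda mOmega K_nondeg)).
apply: filterS2 ug vg => x ug vg Gx.
by rewrite (_ : (u - v) x = u x - v x)// ug// vg//= subrr.
Qed.

(** In the definition of the boundary condition the extension [z] may be
    taken to be [u] itself. *)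
Lemma weak_solutionP f g u : weak_solution f g u <->
  [/\ calV u, extends u g & forall v, V0 v -> Bform u v = L2form lambda Omega f v].
Proof.
split=> [[Vu [z [Vz zg /V0P[_ uz]]] uf]|[Vu ug uf]]; (split;
  [exact: Vu| |exact: uf]).
  apply: filterS2 zg uz => x zg uz Gx; rewrite -zg//.
  by apply/eqP; rewrite -subr_eq0; apply/eqP; exact: uz.
by exists u; split; [exact: Vu|exact: ug|exact: (V0B Vu Vu ug ug)].
Qed.

Lemma Bform_psd : psd_form calV Bform.
Proof.
have [l s p] := weighted_form_psd lambda mOmega K_nondeg
  (energy_weightP mOmega).
split.
- move=> w Vw a u v Vu Vv.
  have VP := subspaceP (calV_subspace lambda mOmega K_nondeg) a Vu Vv.
  rewrite !Bform_weighted//; exact: (l w Vw a u v Vu Vv).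
- move=> u v.
  have swap_uv A : (\int[lambda]_(x in Omega) \int[K x]_(y in A)
      ((u x - u y) * (v x - v y))%:E = \int[lambda]_(x in Omega)
      \int[K x]_(y in A) ((v x - v y) * (u x - u y))%:E)%E.
    by apply: eq_integral => x _; apply: eq_integral => y _; rewrite mulrC.
  by rewrite /Bform !swap_uv.
- by move=> u Vu; rewrite Bform_weighted//; exact: p.
Qed.

Lemma L2form_Veq f u v : L2 f -> calV u -> calV v -> Veq u v ->
  L2form lambda Omega f u = L2form lambda Omega f v.
Proof.
move=> Lf Vu Vv uv; congr fine; apply: ae_eq_integral => //.
- exact: measurable_int (L2_integrable mOmega Lf (calV_L2 Vu)).
- exact: measurable_int (L2_integrable mOmega Lf (calV_L2 Vv)).
- by apply: filterS uv => x uv Ox; rewrite uv//; left.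
Qed.

Lemma Bform_Veq u v v' : calV u -> calV v -> calV v' -> Veq v v' ->
  Bform u v = Bform u v'.
Proof.
move=> Vu Vv Vv' vv'.
rewrite (Bform_weighted mOmega K_nondeg Vu Vv).
rewrite (Bform_weighted mOmega K_nondeg Vu Vv').
exact: (weighted_form_Veq mOmega K_nondeg K_sym (energy_weightP mOmega)
  Vu Vu Vv Vv' (Veq_refl _ _ _ _) vv').
Qed.

Lemma Bform_le_Vform u : calV u -> Bform u u <= Vform lambda Omega K u u.
Proof.
move=> Vu; rewrite (Bform_weighted mOmega K_nondeg Vu Vu) /Vform.
have L0 := psd_ge0 (L2form_psd lambda mOmega) (calV_L2 Vu).
apply: (ler_wpDl L0); rewrite -[leRHS]mul1r.
apply: weighted_form_le; [exact: mOmega|exact: K_nondeg|exact: energy_weightP|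
  exact: weight1|exact: ler01| |exact: Vu].
by move=> z; rewrite mul1r; have /andP[] := energy_weight_bounds Omega z.
Qed.

Lemma form_norm_Bform_le u :
  calV u -> form_norm Bform u <= Vnorm lambda Omega K u.
Proof.
move=> Vu; rewrite -(form_norm_Vform mOmega K_nondeg Vu).
exact: ler_wsqrtr (Bform_le_Vform Vu).
Qed.

(** The summand 2 compensates the weight of [Bform], which is at least 1 / 2. *)
Lemma Vform_le_Bform (C : R) u : calV u ->
  L2norm lambda Omega u ^+ 2 <= C * Bform u u ->
  Vform lambda Omega K u u <= (C + 2) * Bform u u.
Proof.
move=> Vu; rewrite -L2form_norm.
rewrite (sqr_form_norm (L2form_psd lambda mOmega) (calV_L2 Vu)) => LB.
rewrite /Vform mulrDl; apply: lerD => //; rewrite Bform_weighted//.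
apply: weighted_form_le => //; [exact: weight1|exact: energy_weightP|].
by move=> z /=; have /andP[] := energy_weight_bounds Omega z; lra.
Qed.

End zero_data.

(** * Completeness *)

Lemma limn_einf_le (R : realType) (u : nat -> \bar R) (a : \bar R) :
  (forall k, (u k <= a)%E) -> (limn_einf u <= a)%E.
Proof.
move=> ua; rewrite limn_einf_lim; apply: lime_le; first exact: is_cvg_einfs.
apply: nearW => n; apply: (le_trans _ (ua n)).
by apply: ereal_inf_lbound; exists n => /=.
Qed.

Lemma fatou_ae (dT : measure_display) (T : measurableType dT) (R : realType)
    (mu : {measure set T -> \bar R}) (D : set T) (h : nat -> T -> \bar R)
    (g : T -> \bar R) : measurable D ->
  (forall k, measurable_fun D (h k)) -> (forall k x, D x -> (0 <= h k x)%E) ->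
  measurable_fun D g -> (forall x, D x -> (0 <= g x)%E) ->
  {ae mu, forall x, D x -> (g x <= limn_einf (h ^~ x))%E} ->
  (\int[mu]_(x in D) g x <= limn_einf (fun k => \int[mu]_(x in D) h k x))%E.
Proof.
move=> mD mh h0 mg g0 gh.
apply: (le_trans _ (fatou mu mD mh h0)).
apply: ae_ge0_le_integral => //.
- move=> x Dx; rewrite limn_einf_lim; apply: lime_ge; first exact: is_cvg_einfs.
  by apply: nearW => n; apply: le_ereal_inf_tmp => _ [k _ <-]; exact: h0.
- rewrite /limn_einf; apply: measurableT_comp => //.
  apply: (measurable_fun_limn_esup (f := fun k x => (- h k x)%E)) => k.
  exact: measurableT_comp.
Qed.

(** By [2 |a| <= 2 ^ n * a ^ 2 + 2 ^ - n], on a set of finite measure an increment of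
    squared norm [c / 4 ^ n] has an [L1] norm of order [2 ^ - n], so that almost
    everywhere the increments are absolutely summable. *)
Lemma geometric_cvg_ae (dT : measure_display) (T : measurableType dT)
    (R : realType) (mu : {measure set T -> \bar R}) (D : set T)
    (v_ : nat -> T -> R) (c : R) :
  measurable D -> (mu D < +oo)%E -> (forall n, measurable_fun D (v_ n)) -> 0 <= c ->
  (forall n, (\int[mu]_(x in D) ((v_ n.+1 x - v_ n x) ^+ 2)%:E <=
              (c * 4^-1 ^+ n)%:E)%E) ->
  {ae mu, forall x, D x -> cvgn (v_ ^~ x)}.
Proof.
move=> mD Doo mv c0 v_le.
pose g n x : \bar R := `|v_ n.+1 x - v_ n x|%:E.
have mdv n : measurable_fun D (fun x => v_ n.+1 x - v_ n x).
  exact: measurable_funB.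
have mg n : measurable_fun D (g n).
  by apply/measurable_EFinP; exact: measurableT_comp.
have g0 n x : (0 <= g n x)%E by rewrite lee_fin.
pose c' := (c + fine (mu D)) / 2.
have c'0 : 0 <= c' by rewrite divr_ge0// addr_ge0// fine_ge0.
have muD : mu D = (fine (mu D))%:E by rewrite fineK// ge0_fin_numE.
have g_le n : (\int[mu]_(x in D) g n x <= (c' * 2^-1 ^+ n)%:E)%E.
  pose s : R := 2 ^+ n.
  have s0 : 0 < s by rewrite exprn_gt0.
  apply: (@le_trans _ _ (\int[mu]_(x in D) ((s / 2)%:E *
      ((v_ n.+1 x - v_ n x) ^+ 2)%:E + (s^-1 / 2)%:E)))%E.
    apply: ge0_le_integral => //.
    - apply: emeasurable_funD => //; apply: measurable_funeM.
      by apply/measurable_EFinP; exact: measurable_funX.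
    - move=> x _; rewrite -EFinM -EFinD lee_fin.
      set a := _ - _; rewrite -(real_normK (num_real a)).
      have := sqr_ge0 (s * `|a| - 1) => h.
      rewrite -subr_ge0 (_ : _ - _ = (s * `|a| - 1) ^+ 2 / (2 * s)).
        by rewrite divr_ge0// mulr_ge0// ltW.
      by field; rewrite gt_eqF.
  rewrite ge0_integralD//; last 3 first.
  - by move=> x _; rewrite -EFinM lee_fin mulr_ge0 ?sqr_ge0// divr_ge0// ltW.
  - by apply: measurable_funeM; apply/measurable_EFinP; exact: measurable_funX.
  - by move=> x _; rewrite lee_fin divr_ge0// invr_ge0 ltW.
  rewrite ge0_integralZl_EFin ?divr_ge0 ?(ltW s0)//; last 2 first.
  - by move=> x _; rewrite lee_fin sqr_ge0.
  - by apply/measurable_EFinP; exact: measurable_funX.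
  rewrite integral_cst// muD.
  apply: (@le_trans _ _ ((s / 2)%:E * (c * 4^-1 ^+ n)%:E +
      (s^-1 / 2)%:E * (fine (mu D))%:E))%E.
    by rewrite leeD2r// lee_wpmul2l// lee_fin divr_ge0// ltW.
  rewrite -!EFinM -EFinD lee_fin exprVn (_ : 4 = 2 ^+ 2 :> R); last by ring.
  rewrite -exprM mulnC exprM -/s exprVn -/s /c' le_eqVlt; apply/orP; left.
  by apply/eqP; field; rewrite gt_eqF.
have sum_le : (\int[mu]_(x in D) (\sum_(n <oo) g n x) <= (2 * c')%:E)%E.
  rewrite integral_nneseries//.
  apply: (@le_trans _ _ (\sum_(n <oo) (c' * 2^-1 ^+ n)%:E)%E).
    by apply: lee_nneseries => // n _ _; exact: integral_ge0.
  apply: lime_le.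
    apply: is_cvg_nneseries => n _ _.
    by rewrite lee_fin mulr_ge0// exprn_ge0// invr_ge0.
  apply: nearW => n; rewrite sumEFin lee_fin -mulr_sumr mulrC ler_wpM2r//.
  rewrite big_mkord; have /eqP := subrX1 (2^-1 : R) n.
  rewrite -(@opprB _ 1) mulrC => /eqP.
  have : 0 <= 2^-1 ^+ n :> R by rewrite exprn_ge0// invr_ge0.
  by move: (\sum_(i < n) _) (_ ^+ n) => S e e0 E; lra.
have : mu.-integrable D (fun x => \sum_(n <oo) g n x)%E.
  apply/integrableP; split; first exact: ge0_emeasurable_sum.
  under eq_integral do rewrite gee0_abs ?nneseries_ge0//.
  exact: le_lt_trans sum_le (ltry _).
move=> /(integrable_ae mD); apply: filterS => x + Dx => /(_ Dx) fin.
suff tel_cvg : cvgn (series (telescope (v_ ^~ x))).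
  rewrite (_ : v_ ^~ x = (fun n => v_ 0%N x + series (telescope (v_ ^~ x)) n)).
    by apply: is_cvgD => //; exact: is_cvg_cst.
  by apply/funext => n; rewrite -eq_sum_telescope.
apply: (@normed_cvg R R^o); apply: nondecreasing_is_cvgn.
  by apply: nondecreasing_series => k _ _ /=; exact: normr_ge0.
exists (fine (\sum_(n <oo) g n x)%E) => _ [n _ <-].
rewrite -lee_fin fineK// -sumEFin.
by apply: (@nneseries_lim_ge _ (g ^~ x) xpredT 0%N n) => k _ _; exact: g0.
Qed.

Section completeness.
Context (R : realType) (d : nat).
Context (lambda : {measure set Rd R d -> \bar R}) (Omega : set (Rd R d)).
Context (K : R.-sigmafker Rd R d ~> Rd R d).
Context (mOmega : measurable Omega) (K_nondeg : nondegenerate_kernel K)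
  (K_sym : kernel_symmetric lambda K).
Local Notation X := (Rd R d).
Local Notation calV := (calV lambda Omega K).
Local Notation calV0 := (calV0 lambda Omega K).
Local Notation Vnorm_sq := (Vnorm_sq lambda Omega K).
Local Notation Bform := (Bform lambda Omega K).
Local Notation Vform := (Vform lambda Omega K).
Implicit Types (u v w : X -> R).

(** Convergence off a [lambda]-null set is enough for the double integral: by
    [null_kernel] such a set is also [K x]-null for almost every [x] in
    [Omega].  The bound is doubled because the two terms of the squared norm are
    estimated separately. *)
Lemma Vnorm_sq_fatou (h_ : nat -> X -> R) (h : X -> R) (N : set X) (c : \bar R) :
  (forall k, measurable_fun setT (h_ k)) -> measurable_fun setT h ->
  measurable N -> lambda N = 0 ->
  (forall x, ~ N x -> h_ k x @[k --> \oo] --> h x) ->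
  (forall k, (Vnorm_sq (h_ k) <= c)%E) -> (Vnorm_sq h <= c + c)%E.
Proof.
move=> mh_ mh mN N0 h_cvg h_le.
have einf_sqr (a_ : nat -> R) (a : R) : a_ k @[k --> \oo] --> a ->
    ((a ^+ 2)%:E <= limn_einf (fun k => (a_ k ^+ 2)%:E))%E.
  move=> a_cvg.
  have : (fun k => (a_ k ^+ 2)%:E) k @[k --> \oo] --> (a ^+ 2)%:E.
    apply/fine_cvgP; split; first exact: nearW.
    by rewrite expr2; apply: cvg_trans (cvgM a_cvg a_cvg); apply: near_eq_cvg;
      apply: nearW => k /=; rewrite expr2.
  by move=> /cvg_limn_einf_sup[-> _].
have L0 v : (0 <= \int[lambda]_(x in Omega) (v x ^+ 2)%:E)%E.
  by apply: integral_ge0 => x _; rewrite lee_fin sqr_ge0.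
have sqd0 v z : 0 <= sqr_diff v z by rewrite sqr_ge0.
have msqd v : measurable_fun setT v -> measurable_fun setT (sqr_diff v).
  by move=> mv; apply: measurable_funX; exact: measurable_diff.
have I0 v : (0 <= iterated lambda Omega K (sqr_diff v))%E.
  by apply: iterated_ge0.
have aeN : {ae lambda, forall x, ~ N x} by exists N; split=> // x /= /contrapT.
have aeKN : {ae lambda, forall x, Omega x -> K x N = 0}.
  apply: (null_kernel mOmega K_sym) => //.
  apply: (subset_measure0 _ mN _ N0) => //.
  by apply: measurableI => //; exact: measurable_OmegaUGamma.
apply: leeD.
  apply: le_trans (limn_einf_le (fun k => le_trans (leeDl _ (I0 (h_ k))) (h_le k))).
  apply: fatou_ae => //.
  - move=> k; apply/measurable_EFinP; apply: measurable_funX.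
    exact: measurable_funTS.
  - by move=> k x _; rewrite lee_fin sqr_ge0.
  - by apply/measurable_EFinP; apply: measurable_funX; exact: measurable_funTS.
  - by move=> x _; rewrite lee_fin sqr_ge0.
  - by apply: filterS aeN => x nNx _; apply: einf_sqr; exact: h_cvg.
apply: le_trans (limn_einf_le (fun k => le_trans (leeDr _ (L0 (h_ k))) (h_le k))).
apply: (fatou_ae (h := fun k => inner K (sqr_diff (h_ k)))
  (g := inner K (sqr_diff h))) => //.
- by move=> k; apply: measurable_funTS; apply: measurable_inner => //; exact: msqd.
- by move=> k x _; exact: inner_ge0.
- by apply: measurable_funTS; apply: measurable_inner => //; exact: msqd.
- by move=> x _; exact: inner_ge0.
- apply: filterS2 aeN aeKN => x nNx KxN Ox; apply: fatou_ae => //.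
  + by move=> k; apply: measurable_slice; exact: msqd.
  + by move=> k y _; rewrite lee_fin.
  + by apply: measurable_slice; exact: msqd.
  + by move=> y _; rewrite lee_fin.
  + exists N; split => //; first exact: KxN.
    move=> y /= ny; apply: contrapT => nNy; apply: ny => _.
    by apply: einf_sqr; apply: cvgB; exact: h_cvg.
Qed.

(** The [L2] part of the norm makes a geometric Cauchy sequence converge almost
    everywhere on [Omega], and it is constant elsewhere.  The upper limit is a
    total, measurable choice of the limit. *)
Lemma calV0_complete : (lambda Omega < +oo)%E -> friedrichs lambda Omega K ->
  geometrically_complete calV0 Bform.
Proof.
move=> Omega_fin [C C0 HC] v_ v0_ v_cauchy.
have V_ n : calV (v_ n) by case: (v0_ n).
have m_ n : measurable_fun setT (v_ n) by exact: calV_measurable.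
have HV := calV_subspace lambda mOmega K_nondeg.
have HV0 := calV0_subspace lambda mOmega K_nondeg.
have C2 : 0 <= C + 2 by rewrite addr_ge0 // ltW.
pose eps n : R := (C + 2) * 4^-1 ^+ n.
have V_cauchy n k : (n <= k)%N -> (Vnorm_sq (v_ n - v_ k)%R <= (eps n)%:E)%E.
  move=> nk; have Vnk := subspaceB HV (V_ n) (V_ k).
  rewrite (Vnorm_sqE mOmega K_nondeg Vnk) lee_fin.
  have V0nk : V0 lambda Omega K (v_ n - v_ k).
    by apply: calV0_V0; exact: (subspaceB HV0).
  apply: le_trans (Vform_le_Bform mOmega K_nondeg Vnk (HC _ V0nk)) _.
  by rewrite ler_wpM2l// v_cauchy.
have [N [mN N0 subN]] : {ae lambda, forall x, Omega x -> cvgn (v_ ^~ x)}.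
  apply: (geometric_cvg_ae (c := C + 2) mOmega Omega_fin _ C2).
    by move=> n; exact: measurable_funTS.
  move=> n; apply: le_trans (V_cauchy n n.+1 (leqnSn n)).
  apply: (le_trans _ (leeDl _ _)); last first.
    by apply: (iterated_ge0 lambda Omega K (F := sqr_diff (v_ n - v_ n.+1)))
      => z; rewrite sqr_ge0.
  rewrite le_eqVlt; apply/orP; left; apply/eqP/eq_integral => x _.
  by rewrite -sqrrN opprB.
pose u (x : X) : R := fine (limn_esup (fun n => (v_ n x)%:E)).
have mu : measurable_fun setT u.
  apply: measurableT_comp => //.
  apply: (measurable_fun_limn_esup (f := fun n x => (v_ n x)%:E)) => n.
  exact/measurable_EFinP.
have v_u x : ~ N x -> v_ n x @[n --> \oo] --> u x.
  move=> nNx.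
  have /cvg_ex[l v_l] : cvgn (v_ ^~ x).
    have [Ox|nOx] := pselect (Omega x).
      by apply: contrapT => ncvg; apply: nNx; apply: subN => /(_ Ox).
    rewrite (_ : v_ ^~ x = cst 0); first exact: is_cvg_cst.
    by apply/funext => n; have [_ ->] := v0_ n.
  have vE_l : (v_ n x)%:E @[n --> \oo] --> l%:E.
    by apply/fine_cvgP; split; [exact: nearW|exact: v_l].
  by rewrite /u (cvg_limn_einf_sup vE_l).2.
have V_u n : (Vnorm_sq (v_ n - u)%R <= (eps n)%:E + (eps n)%:E)%E.
  apply: (@Vnorm_sq_fatou (fun k => v_ n - v_ (n + k)%N) _ N) => //.
  - by move=> k; exact: measurable_funB.
  - exact: measurable_funB.
  - move=> x nNx; apply: cvgB; first exact: cvg_cst.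
    exact: (cvg_comp _ _ (cvg_addnl n) (v_u x nNx)).
  - by move=> k; apply: V_cauchy; exact: leq_addr.
have calV_u n : calV (v_ n - u).
  split; first exact: measurable_funB.
  by apply: le_lt_trans (V_u n) _; rewrite -EFinD ltry.
exists u.
  split; first by rewrite -(subKr (v_ 0%N) u); exact: (subspaceB HV).
  move=> x nOx; rewrite /u (_ : (fun n => (v_ n x)%:E) = cst 0%E).
    by rewrite (cvg_limn_einf_sup (cvg_cst 0%E)).2.
  by apply/funext => n; have [_ ->] := v0_ n.
have B_le n : 0 <= Bform (v_ n - u) (v_ n - u) <= 2 * eps n.
  rewrite (psd_ge0 (Bform_psd lambda mOmega K_nondeg) (calV_u n)) /=.
  apply: le_trans (Bform_le_Vform mOmega K_nondeg (calV_u n)) _.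
  have := V_u n; rewrite (Vnorm_sqE mOmega K_nondeg (calV_u n)).
  by rewrite -EFinD lee_fin mulrDl mul1r.
apply: (squeeze_cvgr (f := cst 0) (h := fun n => 2 * eps n)).
- exact: nearW.
- exact: cvg_cst.

rewrite -(mulr0 2); apply: cvgMl_tmp; rewrite -(mulr0 (C + 2)); apply: cvgMl_tmp.
by apply: cvg_expr; rewrite ger0_norm ?invr_ge0 ?invf_lt1 ?ltr1n.
Qed.

End completeness.

(** * The Dirichlet problem *)

Section dirichlet_problem.
Context (R : realType) (d : nat).
Context (lambda : {measure set Rd R d -> \bar R}) (Omega : set (Rd R d)).
Context (K : R.-sigmafker Rd R d ~> Rd R d).
Context (mOmega : measurable Omega) (K_nondeg : nondegenerate_kernel K)
  (K_sym : kernel_symmetric lambda K).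
Local Notation X := (Rd R d).
Local Notation L2 := (L2 lambda Omega).
Local Notation L2norm := (L2norm lambda Omega).
Local Notation L2form := (L2form lambda Omega).
Local Notation calV := (calV lambda Omega K).
Local Notation calV0 := (calV0 lambda Omega K).
Local Notation V0 := (V0 lambda Omega K).
Local Notation Veq := (Veq lambda Omega K).
Local Notation extends := (extends lambda Omega K).
Local Notation trace_space := (trace_space lambda Omega K).
Local Notation Vnorm := (Vnorm lambda Omega K).
Local Notation Tnorm := (Tnorm lambda Omega K).
Local Notation Bform := (Bform lambda Omega K).
Local Notation Vform := (Vform lambda Omega K).
Local Notation weak_solution := (weak_solution lambda Omega K).
Implicit Types (u v w z f g : X -> R).

Let HL2 := L2_subspace lambda mOmega.
Let HV := calV_subspace lambda mOmega K_nondeg.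
Let HV0 := V0_subspace mOmega K_nondeg K_sym.
Let L2psd := L2form_psd lambda mOmega.
Let Vpsd := Vform_psd lambda mOmega K_nondeg.
Let Bpsd := Bform_psd lambda mOmega K_nondeg.

Context (C : R) (C_gt0 : 0 < C).
Context (HC : forall v, V0 v -> L2norm v ^+ 2 <= C * Bform v v).
Local Notation s := (Num.sqrt (C + 2)).

Lemma Vnorm_le_Bform v : V0 v -> Vnorm v <= s * form_norm Bform v.
Proof.
move=> V0v; have Vv := V0_calV V0v.
rewrite -(form_norm_Vform mOmega K_nondeg Vv) /form_norm -sqrtrM; last first.
  by rewrite addr_ge0// ltW.
exact: ler_wsqrtr (Vform_le_Bform mOmega K_nondeg Vv (HC V0v)).
Qed.

Lemma L2norm_le_Vnorm v : calV v -> L2norm v <= Vnorm v.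
Proof.
move=> Vv; rewrite -(form_norm_Vform mOmega K_nondeg Vv) -L2form_norm.
apply: ler_wsqrtr; rewrite /Vform lerDl.
exact: (psd_ge0 (weighted_form_psd lambda mOmega K_nondeg (weight1 R d)) Vv).
Qed.

Lemma load_bound f v : L2 f -> V0 v ->
  `|L2form f v| <= s * L2norm f * form_norm Bform v.
Proof.
move=> Lf V0v; have Vv := V0_calV V0v.
apply: le_trans (psd_norm_cauchy_schwarz HL2 L2psd Lf (calV_L2 Vv)) _.
rewrite L2form_norm mulrAC [leRHS]mulrC ler_wpM2l ?sqrtr_ge0//.
exact: le_trans (L2norm_le_Vnorm Vv) (Vnorm_le_Bform V0v).
Qed.

Lemma trace_spaceB g g' : trace_space g -> trace_space g' -> trace_space (g - g').
Proof.
move=> [u Vu ug] [u' Vu' ug']; exists (u - u'); first exact: (subspaceB HV).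
by apply: filterS2 ug ug' => x ug ug' Gx; rewrite [LHS](_ : _ = u x - u' x)// ug// ug'.
Qed.

Lemma weak_solutionB f g u f' g' u' : L2 f -> L2 f' ->
  weak_solution f g u -> weak_solution f' g' u' ->
  weak_solution (f - f') (g - g') (u - u').
Proof.
move=> Lf Lf' /(weak_solutionP mOmega K_nondeg K_sym)[Vu ug uf].
move=> /(weak_solutionP mOmega K_nondeg K_sym)[Vu' ug' uf'].
apply/(weak_solutionP mOmega K_nondeg K_sym); split.
- exact: (subspaceB HV).
- by apply: filterS2 ug ug' => x ug ug' Gx; rewrite [LHS](_ : _ = u x - u' x)// ug// ug'.
- move=> v V0v; have Vv := V0_calV V0v.
  rewrite (linear_onB (psd_linear Bpsd Vv) Vu Vu') (uf _ V0v) (uf' _ V0v).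
  by rewrite (linear_onB (psd_linear L2psd (calV_L2 Vv)) Lf Lf').
Qed.

Lemma weak_solution_unique f g u u' :
  weak_solution f g u -> weak_solution f g u' -> Veq u' u.
Proof.
move=> /(weak_solutionP mOmega K_nondeg K_sym)[Vu ug uf].
move=> /(weak_solutionP mOmega K_nondeg K_sym)[Vu' ug' uf'].
have V0w := V0B mOmega K_nondeg K_sym Vu' Vu ug' ug.
have Vw := V0_calV V0w.
have B0 : Bform (u' - u) (u' - u) = 0.
  rewrite (linear_onB (psd_linear Bpsd Vw) Vu' Vu) (uf _ V0w) (uf' _ V0w).
  by rewrite subrr.
have : Veq (u' - u) (cst 0).
  apply: (Vnorm_sq0_Veq mOmega K_nondeg K_sym Vw).
  rewrite (Vnorm_sqE mOmega K_nondeg Vw); congr _%:E; apply/eqP.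
  rewrite eq_le (psd_ge0 Vpsd Vw) andbT.
  by have := Vform_le_Bform mOmega K_nondeg Vw (HC V0w); rewrite B0 mulr0.
by apply: filterS => x w0 Dx; apply/eqP; rewrite -subr_eq0; apply/eqP; exact: w0.
Qed.

(** Testing with [u - z] for an extension [z] of the boundary data bounds the
    energy of [u - z]. *)
Lemma weak_solution_le_extension f g u z : L2 f -> weak_solution f g u ->
  calV z -> extends z g ->
  Vnorm u <= (s ^+ 2 + s + 1) * (L2norm f + Vnorm z).
Proof.
move=> Lf /(weak_solutionP mOmega K_nondeg K_sym)[Vu ug uf] Vz zg.
have V0w := V0B mOmega K_nondeg K_sym Vu Vz ug zg.
have Vw := V0_calV V0w.
pose beta := form_norm Bform (u - z).
have s0 : 0 <= s := sqrtr_ge0 _; have beta0 : 0 <= beta := sqrtr_ge0 _.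
have f0 : 0 <= L2norm f := sqrtr_ge0 _; have z0 : 0 <= Vnorm z := sqrtr_ge0 _.
have beta_sq : beta ^+ 2 <= (s * L2norm f + Vnorm z) * beta.
  rewrite /beta (sqr_form_norm Bpsd Vw).
  rewrite (linear_onB (psd_linear Bpsd Vw) Vu Vz) (uf _ V0w) mulrDl.
  apply: le_trans (ler_norm _) _; apply: le_trans (ler_normB _ _) _.
  apply: lerD; first exact: load_bound.
  apply: le_trans (psd_norm_cauchy_schwarz HV Bpsd Vz Vw) _.
  apply: ler_wpM2r; first exact: beta0.
  exact: form_norm_Bform_le.
have beta_le : beta <= s * L2norm f + Vnorm z.
  have [b0|b0] := leP beta 0; last by rewrite -(ler_pM2r b0) -expr2.
  by apply: le_trans b0 _; rewrite addr_ge0// mulr_ge0.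
have u_le : Vnorm u <= s * beta + Vnorm z.
  have := psd_norm_triangle HV Vpsd Vw Vz; rewrite subrK.
  rewrite !(form_norm_Vform mOmega K_nondeg)// => h.
  by apply: le_trans h _; rewrite lerD2r; exact: Vnorm_le_Bform.
apply: le_trans u_le _; have := ler_wpM2l s0 beta_le.
have := mulr_ge0 s0 f0; have := mulr_ge0 (sqr_ge0 s) z0.
by rewrite !mulrDr !mulrDl !mul1r mulrA -expr2; lra.
Qed.

Lemma weak_solution_bound f g u : L2 f -> trace_space g -> weak_solution f g u ->
  Vnorm u <= (s ^+ 2 + s + 1) * (L2norm f + Tnorm g).
Proof.
move=> Lf [z0 Vz0 z0g] uf.
have D0 : 0 < s ^+ 2 + s + 1.
  by rewrite ltr_pwDr// addr_ge0 ?sqr_ge0 ?sqrtr_ge0.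
rewrite mulrC -ler_pdivrMr// -lerBlDl; apply: lb_le_inf.
  by exists (Vnorm z0); exists z0.
move=> _ [z [Vz zg] <-]; rewrite lerBlDl ler_pdivrMr// mulrC.
exact: weak_solution_le_extension zg.
Qed.

(** Subtracting an extension [z] of the boundary data reduces the problem to
    functions vanishing off [Omega], where the Riesz theorem applies. *)
Lemma weak_solution_exists f g : (lambda Omega < +oo)%E ->
  L2 f -> trace_space g -> exists u, weak_solution f g u.
Proof.
move=> Omega_fin Lf [z Vz zg].
have H0 := calV0_subspace lambda mOmega K_nondeg.
have calV0_sub : calV0 `<=` calV by move=> v [].
have complete : geometrically_complete calV0 Bform.
  by apply: (calV0_complete mOmega K_nondeg K_sym Omega_fin); exists C.
pose l v := L2form f v - Bform z v.
have l_linear : linear_on calV0 l.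
  move=> a v w [Vv _] [Vw _]; rewrite /l.
  rewrite !(psd_sym L2psd f) !(psd_sym Bpsd z).
  rewrite (psd_linear L2psd Lf a (calV_L2 Vv) (calV_L2 Vw)).
  by rewrite (psd_linear Bpsd Vz a Vv Vw); ring.
have l_bounded v : calV0 v ->
    `|l v| <= (s * L2norm f + form_norm Bform z) * form_norm Bform v.
  move=> V0v; have [Vv _] := V0v; rewrite mulrDl.
  apply: le_trans (ler_normB _ _) _; apply: lerD.
    by apply: load_bound => //; exact: calV0_V0.
  exact: (psd_norm_cauchy_schwarz HV Bpsd Vz Vv).
have [w V0w wl] := psd_riesz H0 (psd_formS calV0_sub Bpsd) complete
  l_linear l_bounded.
have [Vw w0] := V0w.
exists (z + w); apply/(weak_solutionP mOmega K_nondeg K_sym).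
have Vzw : calV (z + w) by exact: (subspaceD HV).
split; first exact: Vzw.
  apply: filterS zg => x zg Gx; have [nOx _] := Gx.
  by rewrite [LHS](_ : _ = z x + w x)// w0// addr0 zg.
move=> v [Vv [v' V0v' vv']]; have [Vv' _] := V0v'.
rewrite (Bform_Veq mOmega K_nondeg K_sym Vzw Vv Vv' vv').
rewrite (L2form_Veq mOmega Lf Vv Vv' vv').
by rewrite (linear_onD (psd_linear Bpsd Vv') Vz Vw) wl// /l addrC subrK.
Qed.

End dirichlet_problem.

Set Strict Implicit.
Unset Implicit Arguments.

Theorem theorem5p2 (R : realType) (d : nat)
    (lambda : {measure set Rd R d -> \bar R})
    (Omega : set (Rd R d))
    (Omega_neq0 : Omega !=set0)
    (Omega_open : open (Omega : set 'rV[R]_d))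
    (Omega_fin : (lambda Omega < +oo)%E)
    (K : R.-sigmafker Rd R d ~> Rd R d)
    (K_nondeg : nondegenerate_kernel K)
    (K_sym : kernel_symmetric lambda K)
    (Hfriedrichs : friedrichs lambda Omega K) :
  (exists2 C : R, 0 < C &
    forall f g : Rd R d -> R,
      L2 lambda Omega f -> trace_space lambda Omega K g ->
      exists u : Rd R d -> R,
        [/\ weak_solution lambda Omega K f g u,
            forall u', weak_solution lambda Omega K f g u' ->
              Veq lambda Omega K u' u &
            Vnorm lambda Omega K u <=
              C * (L2norm lambda Omega f + Tnorm lambda Omega K g)]) /\
  (forall f g u : Rd R d -> R,
    L2 lambda Omega f -> trace_space lambda Omega K g ->
    weak_solution lambda Omega K f g u ->
    forall eps : R, 0 < eps ->
    exists2 delta : R, 0 < delta &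
      forall f' g' u' : Rd R d -> R,
        L2 lambda Omega f' -> trace_space lambda Omega K g' ->
        weak_solution lambda Omega K f' g' u' ->
        L2norm lambda Omega (f' \- f) < delta ->
        Tnorm lambda Omega K (g' \- g) < delta ->
        Vnorm lambda Omega K (u' \- u) < eps).
Proof.
have mOmega : measurable Omega by exact: sub_sigma_algebra.
have [C C0 HC] := Hfriedrichs.
pose D := Num.sqrt (C + 2) ^+ 2 + Num.sqrt (C + 2) + 1.
have D0 : 0 < D by rewrite ltr_pwDr// addr_ge0 ?sqr_ge0 ?sqrtr_ge0.
split.
  exists D => // f g Lf Tg.
  have [u uf] := weak_solution_exists mOmega K_nondeg K_sym C0 HC Omega_fin Lf Tg.
  exists u; split; first exact: uf.
    by move=> u'; exact: (weak_solution_unique mOmega K_nondeg K_sym HC).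
  exact: (weak_solution_bound mOmega K_nondeg K_sym C0 HC Lf Tg uf).
move=> f g u Lf Tg uf eps eps0.
exists (eps / (2 * D)); first by rewrite divr_gt0// mulr_gt0.
move=> f' g' u' Lf' Tg' uf' ff' gg'.
have Lff' := subspaceB (L2_subspace lambda mOmega) Lf' Lf.
have Tgg' := trace_spaceB mOmega K_nondeg Tg' Tg.
have uuf := weak_solutionB mOmega K_nondeg K_sym Lf' Lf uf' uf.
apply: le_lt_trans (weak_solution_bound mOmega K_nondeg K_sym C0 HC Lff' Tgg' uuf) _.
rewrite -/D mulrC -ltr_pdivlMr//.
apply: lt_le_trans (ltrD ff' gg') _.
rewrite le_eqVlt; apply/orP; left; apply/eqP; field.
by rewrite gt_eqF.
Qed.
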